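(* Fix an integer $d\ge 2$ and let $k=k(p)$, $1\le k\le p$, be integers with $k=o(p)$ as $p\to\infty$. Suppose $\tilde{\mathrm P}_p$ is either the Bernoulli prior (for all $p$) or the Bernoulli-Rademacher prior (for all $p$), and let $\mathrm P_N$ be the induced prior distribution on $\mathbb R^N=\mathbb R^{p^d}$, with $M_N$ the cardinality of its support. Then for any $t\in[0,1]$, $$\limsup_{N\to\infty}\frac{1}{\log M_N}\log \mathrm P_N^{\otimes 2}\left[\langle\mathbf X,\mathbf X'\rangle\ge t\right]\le-\frac{2t}{1+t},$$ where $\mathbf X,\mathbf X'$ are independent draws from $\mathrm P_N$, $N=p^d$, and the limit is along $p\to\infty$.
   Context: For $\mathbf x\in\mathbb R^p$, $\mathbf x^{\otimes d}\in\mathbb R^{p^d}$ denotes the vector whose entry indexed by $(i_1,\dots,i_d)\in\{1,\dots,p\}^d$ is $\mathbf x_{i_1}\cdots\mathbf x_{i_d}$. Bernoulli prior: $\tilde{\mathrm P}_p$ is the uniform distribution over the vectors in $\{0,1/\sqrt k\}^p$ with exactly $k$ nonzero entries. Bernoulli-Rademacher prior: $\tilde{\mathrm P}_p$ is the uniform distribution over the vectors in $\{-1/\sqrt k,0,1/\sqrt k\}^p$ with exactly $k$ nonzero entries. The induced prior $\mathrm P_N$ is the law of $\mathbf X=\mathbf x^{\otimes d}$ with $\mathbf x\sim\tilde{\mathrm P}_p$ (which is uniform on its finite support). *)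

(* Defs.v *)
From HB Require Import structures.
From mathcomp Require Import all_boot all_order all_algebra.
From mathcomp Require Import finmap.
From mathcomp Require Import all_classical all_reals all_analysis.
Set Implicit Arguments.
Unset Strict Implicit.
Unset Printing Implicit Defensive.
Import Order.TTheory GRing.Theory Num.Theory.
Import numFieldNormedType.Exports.
Local Open Scope classical_set_scope.
Local Open Scope ring_scope.

(* The space R^n, with the product sigma-algebra carried by n-tuples. *)
Notation Rvec R n := (n.-tuple (measurableTypeR R)).

Definition inner (R : realType) (n : nat) (X Y : Rvec R n) : R :=
  \sum_(j < n) (tnth X j : R) * tnth Y j.

Lemma card_multi_index (d p : nat) : #|{: d.-tuple 'I_p}| = (p ^ d)%N.
Proof. by rewrite card_tuple card_ord. Qed.

(* A coordinate of R^(p^d) is identified with a multi-index (i_1, ..., i_d)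
   through the enumeration of d.-tuple 'I_p. *)
Definition multi_index (d p : nat) (j : 'I_(p ^ d)) : d.-tuple 'I_p :=
  enum_val (cast_ord (esym (card_multi_index d p)) j).

Definition tensor_power (R : realType) (d p : nat) (x : Rvec R p) :
    Rvec R (p ^ d) :=
  [tuple \prod_(a < d) (tnth x (tnth (multi_index j) a) : R) | j < p ^ d].

Lemma measurable_tensor_power (R : realType) (d p : nat) :
  measurable_fun [set: Rvec R p] (@tensor_power R d p).
Proof.
apply/measurable_fun_tnthP => j.
rewrite (_ : _ \o _ = fun x : Rvec R p =>
    \prod_(a < d) tnth x (tnth (multi_index j) a)); last first.
  by apply/funext => x /=; rewrite tnth_mktuple.
by apply: measurable_prod => a _; exact: measurable_tnth.
Qed.

HB.instance Definition _ (R : realType) (d p : nat) :=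
  isMeasurableFun.Build _ _ _ _ (@tensor_power R d p)
    (@measurable_tensor_power R d p).

(* Uniform distribution on a finite nonempty set S. The Dirac mass is a dummy
   value that makes it a probability when S is empty or infinite. *)
Definition uniform_on (R : realType) d (T : measurableType d) (S : set T)
    (E : set T) : \bar R :=
  if `[< finite_set S /\ S !=set0 >]
  then (#|` fset_set (S `&` E)|%:R / #|` fset_set S|%:R)%:E
  else \d_point E.

Section uniform_on.
Context (R : realType) d (T : measurableType d) (S : set T).

Let scale : {nonneg R} := (#|` fset_set S|%:R^-1)%:nng.
Let atom (i : nat) : {measure set T -> \bar R} :=
  \d_(nth point (fset_set S) i).

Lemma uniform_onE : finite_set S -> S !=set0 ->
  uniform_on R S = mscale scale (msum atom #|` fset_set S|).
Proof.
move=> finS S0; apply/funext => E.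
rewrite /uniform_on asboolT // /mscale /msum /= mulrC EFinM; congr (_ * _)%E.
rewrite /msum; under eq_bigr do rewrite /= /dirac indicE.
rewrite sumEFin; congr EFin.
rewrite -(big_mkord xpredT
  (fun i => (nth point (fset_set S) i \in E)%:R : R)).
rewrite -(big_nth point xpredT (fun x => (x \in E)%:R : R)).
rewrite -natr_sum -big_mkcond /= sum1_count; congr (_%:R).
rewrite -size_filter; apply: (@perm_size T); apply: uniq_perm.
- exact: fset_uniq.
- exact/filter_uniq/fset_uniq.
- move=> x; rewrite mem_filter !in_fset_set ?in_setI 1?andbC //.
  exact: finite_setIl.
Qed.

Let uniform0 : uniform_on R S set0 = 0%E.
Proof.
case: (pselect (finite_set S /\ S !=set0)) => [[fS S0]|nS].
  by rewrite uniform_onE // measure0.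
by rewrite /uniform_on asboolF // measure0.
Qed.

Let uniform_ge0 E : (0 <= uniform_on R S E)%E.
Proof.
by rewrite /uniform_on; case: ifP => _ //; rewrite lee_fin divr_ge0.
Qed.

Let uniform_sigma_additive : semi_sigma_additive (uniform_on R S).
Proof.
case: (pselect (finite_set S /\ S !=set0)) => [[fS S0]|nS].
  by rewrite uniform_onE //; exact: measure_semi_sigma_additive.
rewrite (_ : uniform_on R S = \d_point); last first.
  by apply/funext => E; rewrite /uniform_on asboolF.
exact: measure_semi_sigma_additive.
Qed.

HB.instance Definition _ := isMeasure.Build _ _ _ (uniform_on R S)
  uniform0 uniform_ge0 uniform_sigma_additive.

Let uniform_setT : uniform_on R S setT = 1%E.
Proof.
rewrite /uniform_on; case: asboolP => [[fS S0]|nS]; last exact: probability_setT.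
have [x Sx] := S0; rewrite setIT divff // pnatr_eq0 cardfs_eq0.
apply/negP => /eqP S_eq0.
have : x \in fset_set S by rewrite in_fset_set // inE.
by rewrite S_eq0 inE.
Qed.

HB.instance Definition _ :=
  Measure_isProbability.Build _ _ _ (uniform_on R S) uniform_setT.

End uniform_on.

Variant prior_kind := Bernoulli | BernoulliRademacher.

Definition prior_entries (R : realType) (kind : prior_kind) (k : nat) : set R :=
  match kind with
  | Bernoulli => [set 0; (Num.sqrt k%:R)^-1]
  | BernoulliRademacher => [set - (Num.sqrt k%:R)^-1; 0; (Num.sqrt k%:R)^-1]
  end.

Definition prior_vectors (R : realType) (kind : prior_kind) (p k : nat) :
    set (Rvec R p) :=
  [set x | (forall i, prior_entries kind k (tnth x i)) /\
           #|[pred i | tnth x i != 0]| = k].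
Arguments prior_vectors : clear implicits.

Lemma finite_prior_vectors (R : realType) (kind : prior_kind) (p k : nat) : finite_set (prior_vectors R kind p k).
Proof.
set s := (Num.sqrt k%:R)^-1 : R.
apply: (@sub_finite_set _ _ ((fun f : {ffun 'I_p -> bool * bool} =>
  [tuple (if (f i).1 then (if (f i).2 then s else - s) else 0) | i < p]) @` setT)).
  move=> x [hx _]; exists [ffun i => (tnth x i != 0, tnth x i == s)] => //.
  apply: eq_from_tnth => i; rewrite tnth_mktuple ffunE /=.
  have := hx i; rewrite /prior_entries -/s.
  case: eqP => [//|/= n0]; case: eqP => [//|ns]; case: kind hx => hx /=.
   by case.
  by case=> [[]|].
exact: finite_image.
Qed.

Lemma prior_vectors_neq0 (R : realType) (kind : prior_kind) (p k : nat) : (0 < k <= p)%N ->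
  prior_vectors R kind p k !=set0.
Proof.
case/andP=> k0 kp; set s := (Num.sqrt k%:R)^-1 : R.
have sn : s != 0 by rewrite invr_eq0 gt_eqF // sqrtr_gt0 ltr0n.
exists [tuple (if (i < k)%N then s else 0) | i < p]; split.
  by move=> i; rewrite tnth_mktuple; case: kind; case: ifP => _ /=; tauto.
rewrite -[RHS](card_ord k).
rewrite -(@fintype.card_image _ _ (widen_ord kp)); last by move=> i j []/ord_inj.
apply: eq_card => i; rewrite !inE tnth_mktuple; apply/idP/fintype.imageP.
  case: ifP => [ik _|]; last by rewrite eqxx.
  by exists (Ordinal ik) => //; exact: val_inj.
by case=> j _ -> /=; rewrite ltn_ord.
Qed.

Definition prior (R : realType) (kind : prior_kind) (p k : nat) :
    probability (Rvec R p) R :=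
  uniform_on R (prior_vectors R kind p k).
Arguments prior : clear implicits.

Definition induced_prior (R : realType) (kind : prior_kind) (d p k : nat) :
    probability (Rvec R (p ^ d)) R :=
  distribution (prior R kind p k) (@tensor_power R d p).
Arguments induced_prior : clear implicits.

(* The laws considered here are purely atomic with finitely many atoms. *)
Definition support_card (R : realType) (n : nat)
    (P : probability (Rvec R n) R) : nat :=
  #|` fset_set [set X : Rvec R n | P [set X] != 0%E]|.

(* Main.v *)
Require Import Defs.
From mathcomp Require Import all_boot all_order all_algebra.
From mathcomp Require Import finmap.
From mathcomp Require Import all_classical all_reals all_analysis.
From mathcomp Require Import measurable_realfun zify ring lra.
Import Order.TTheory GRing.Theory Num.Theory.
Import numFieldNormedType.Exports.
Local Open Scope classical_set_scope.
Local Open Scope ring_scope.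

(** Only the sizes of the supports matter: signs, the exponent d and the exact
cardinalities all cost factors exp(O(k)), while log M_N has order k ln(p/k)
and p/k tends to infinity.

The inner product of two tensor powers is the d-th power of <x, x'>
([inner_tensor_power]), and |<x, x'>| is at most o, the size of the overlap of
the two supports divided by k ([normr_inner_le_overlap]).  Since o <= 1 and
d >= 2, the event t <= <x, x'>^d forces t <= o^2.  The number
s = 2t/(1+t) satisfies s^2 <= t, as t (1+t)^2 - 4 t^2 = t (1-t)^2, so the event
forces an overlap of at least s k.

For a fixed x, a union bound over the m-element subsets of the support of x
([card_big_overlap]) shows that at most 2^k C(k, m) C(p-m, k-m) prior vectors
have overlap at least m with x.  There are at least C(p, k) prior vectors and
C(p-m, k-m) / C(p, k) <= (k/p)^m ([bin_ratio]), so that the probability is at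
most 4^k (k/p)^m ([pair_prob_le]).  With m the ceiling of s k its logarithm is
at most k (ln 4 - s L), where L = ln (p/k) ([lne_pair_prob_le]).

On the other side 1 < M_N <= 2^k C(p, k) <= (2 e p/k)^k, hence
0 < ln M_N <= k (1 + ln 2 + L) ([support_card_gt1], [ln_support_card_le]).  The
factor k cancels in the quotient, and letting L tend to infinity gives the
limit -s. *)

Set Implicit Arguments.
Unset Strict Implicit.
Unset Printing Implicit Defensive.

(** * Counting subsets *)

(** Removing C maps these sets injectively to the subsets of the complement of C
of size k - #|C|.  When #|C| exceeds k, there is nothing to count. *)
Lemma card_draws_containing (T : finType) (C : {set T}) (k : nat) :
  (#|[set B : {set T} | (C \subset B) && (#|B| == k)]%SET|
     <= 'C(#|T| - #|C|, k - #|C|))%N.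
Proof.
have -> : (#|T| - #|C| = #|~: C|)%N by rewrite -(cardsC C) addKn.
rewrite -cards_draws.
rewrite -(@card_in_imset _ _ (fun B : {set T} => B :\: C)).
  apply/subset_leq_card/fintype.subsetP => _
    /finset.imsetP[B /[!inE] /andP[CB /eqP Bk] ->].
  by rewrite finset.setDE finset.subsetIr -finset.setDE cardsDS// Bk eqxx.
move=> B B'; rewrite !inE => /andP[CB _] /andP[CB' _] E.
by rewrite -(finset.setID B C) -(finset.setID B' C) E !(finset.setIidPr _).
Qed.

(** Union bound: a set meeting A in at least m points contains one of the
'C(#|A|, m) subsets of A of size m. *)
Lemma card_big_overlap (T : finType) (A : {set T}) (k m : nat) :
  (#|[set B : {set T} | (#|B| == k) && (m <= #|A :&: B|)%N]%SET|
     <= 'C(#|A|, m) * 'C(#|T| - m, k - m))%N.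
Proof.
set F := [set B : {set T} | _]%SET.
set D := [set C : {set T} | C \subset A & #|C| == m]%SET.
set G := fun C : {set T} =>
  [set B : {set T} | (C \subset B) && (#|B| == k)]%SET.
apply: (@leq_trans #|(\bigcup_(C in D) G C)%SET|).
  apply/subset_leq_card/fintype.subsetP => B; rewrite inE => /andP[Bk mAB].
  have : (0 < #|[set C : {set T} | C \subset (A :&: B) & #|C| == m]%SET|)%N.
    by rewrite cards_draws bin_gt0.
  case/card_gt0P => C; rewrite inE finset.subsetI => /andP[/andP[CA CB] Cm].
  by apply/finset.bigcupP; exists C; rewrite inE ?CA ?CB.
apply: (@leq_trans (\sum_(C in D) #|G C|)).
  elim/big_rec2: _ => [|C n U _ IH]; first by rewrite cards0.
  by apply: leq_trans (leq_card_setU _ _) _; rewrite leq_add2l.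
rewrite -cards_draws -sum_nat_const leq_sum // => C.
rewrite inE => /andP[_ /eqP <-].
exact: card_draws_containing.
Qed.

(** The quotient 'C(p - m, k - m) / 'C(p, k) is the product of the m factors
(k - i) / (p - i), i < m, each at most k / p. *)
Lemma bin_ratio (p k m : nat) : (m <= k <= p)%N ->
  ('C(p - m, k - m) * p ^ m <= k ^ m * 'C(p, k))%N.
Proof.
case/andP => mk kp; elim: m mk => [|m IHm] mk; first by rewrite !subn0 mulnC.
have := IHm (ltnW mk).
have -> : (p - m = (p - m.+1).+1)%N by lia.
have -> : (k - m = (k - m.+1).+1)%N by lia.
set a := (p - m.+1)%N; set b := (k - m.+1)%N => IH.
have diag := mul_bin_diag a.+1 b; rewrite /= in diag.
rewrite !expnS.
have ab : (b.+1 * p <= k * a.+1)%N by rewrite /a /b; nia.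
rewrite -(@leq_pmul2l a.+1) //.
have -> : (a.+1 * ('C(a, b) * (p * p ^ m)) =
    b.+1 * p * ('C(a.+1, b.+1) * p ^ m))%N.
  by rewrite mulnA diag; ring.
have -> : (a.+1 * (k * k ^ m * 'C(p, k)) =
    k * a.+1 * (k ^ m * 'C(p, k)))%N by ring.
exact: leq_mul.
Qed.

Lemma ffact_le_expn (n m : nat) : (n ^_ m <= n ^ m)%N.
Proof.
elim: m => // m IHm; rewrite ffactnSr expnSr leq_mul //.
exact: leq_subr.
Qed.

(** From 'C(p, k) <= p^k / k! and k^k / k! <= e^k, the latter quotient being one
term of the exponential series at k. *)
Lemma bin_le_expR (R : realType) (p k : nat) : (0 < k)%N ->
  'C(p, k)%:R <= (expR 1 * (p%:R / k%:R)) ^+ k :> R.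
Proof.
case: k => // n _; set k := n.+1.
have k0 : 0 < k%:R :> R by rewrite ltr0n.
have f0 : 0 < k`!%:R :> R by rewrite ltr0n fact_gt0.
have kk : k%:R ^+ k <= k`!%:R * expR 1 ^+ k :> R.
  rewrite -expRM_natl mulr1 -ler_pdivrMl// mulrC.
  apply: le_trans (expR_ge1Dxn n (ltW k0)); lra.
rewrite exprMn expr_div_n mulrA ler_pdivlMr ?exprn_gt0//.
have ffp : 'C(p, k)%:R * k`!%:R <= p%:R ^+ k :> R.
  by rewrite -natrM bin_ffact -natrX ler_nat ffact_le_expn.
rewrite -(ler_pM2r f0).
rewrite mulrAC.
have c0 : 0 <= expR 1 ^+ k :> R by rewrite exprn_ge0// expR_ge0.
apply: le_trans (_ : p%:R ^+ k * k%:R ^+ k <= _).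
  by rewrite ler_wpM2r// exprn_ge0// ltW.
by rewrite (mulrC (expR 1 ^+ k)) -mulrA ler_wpM2l ?exprn_ge0// mulrC.
Qed.

(** * Vectors of the prior *)

Definition supp {R : realType} {p : nat} (x : Rvec R p) : {set 'I_p} :=
  [set i | tnth x i != 0]%SET.

Definition entry_size (R : realType) (k : nat) : R := (Num.sqrt k%:R)^-1.

Lemma entry_size_gt0 (R : realType) (k : nat) : (0 < k)%N -> 0 < entry_size R k.
Proof. by move=> k0; rewrite invr_gt0 sqrtr_gt0 ltr0n. Qed.

Lemma entry_size_sqr (R : realType) (k : nat) : entry_size R k ^+ 2 = k%:R^-1.
Proof. by rewrite exprVn sqr_sqrtr. Qed.

(** The first set carries the nonzero entries, and the second one the positive
entries among them. *)
Definition signed_vector (R : realType) (p k : nat)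
    (u : {set 'I_p} * {set 'I_p}) : Rvec R p :=
  [tuple (if i \in u.1 then
            if i \in u.2 then entry_size R k else - entry_size R k
          else 0) | i < p].

Lemma prior_entryP (R : realType) (kind : prior_kind) (p k : nat)
    (x : Rvec R p) (i : 'I_p) :
  prior_vectors R kind p k x ->
  [\/ tnth x i = 0, tnth x i = entry_size R k | tnth x i = - entry_size R k].
Proof.
case=> /(_ i) + _; rewrite -/(entry_size R k); case: kind => /=.
  by case=> ->; [constructor 1|constructor 2].
by case=> [[]|] ->; [constructor 3|constructor 1|constructor 2].
Qed.

Lemma card_supp_prior (R : realType) (kind : prior_kind) (p k : nat)
    (x : Rvec R p) :
  prior_vectors R kind p k x -> #|supp x| = k.
Proof. by case=> _ <-; apply: eq_card => i; rewrite !inE. Qed.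

Lemma prior_signed_vector (R : realType) (kind : prior_kind) (p k : nat)
    (x : Rvec R p) : prior_vectors R kind p k x ->
  exists2 C : {set 'I_p}, C \subset supp x & x = signed_vector R k (supp x, C).
Proof.
move=> Sx; exists [set i in supp x | tnth x i == entry_size R k]%SET.
  by apply/fintype.subsetP => i; rewrite inE => /andP[].
apply: eq_from_tnth => i; rewrite tnth_mktuple /= !inE.
case: eqP => //= x0; case: eqP => // xs.
by case: (prior_entryP i Sx).
Qed.

(** A vector of either prior is determined by its support, of size k, and by the
set of its positive entries, for which 2^k choices remain. *)
Lemma card_prior_supp_le (R : realType) (kind : prior_kind) (p k : nat)
    (F : {set {set 'I_p}}) :
  (#|` fset_set (prior_vectors R kind p k `&` [set x | supp x \in F])|
     <= 2 ^ k * #|F|)%N.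
Proof.
set E := _ `&` _.
have fE : finite_set E by apply: finite_setIl; exact: finite_prior_vectors.
pose D := [set u : {set 'I_p} * {set 'I_p} |
            [&& u.1 \in F, #|u.1| == k & u.2 \subset u.1]]%SET.
apply: (@leq_trans #|D|).
  apply: (@leq_trans #|` [fset signed_vector R k u | u in D]%fset|).
    apply: fsubset_leq_card; apply/fsubsetP => x; rewrite in_fset_set // inE.
    move=> -[Sx /= Fx]; have [C Cx ->] := prior_signed_vector Sx.
    apply/imfsetP; exists (supp x, C) => //=.
    by rewrite inE /= Fx Cx (card_supp_prior Sx) eqxx.
  by rewrite (leq_trans (leq_imfset_card _ _ _)) // cardE.
have -> : #|D| = (\sum_(B in F | #|B| == k) #|powerset B|)%N.
  rewrite -sum1_card.
  rewrite [RHS](eq_bigr (fun B => \sum_(C in powerset B) 1)%N); last first.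
    by move=> B _; rewrite sum1_card.
  rewrite pair_big_dep /=; apply: eq_bigl => -[B C]; rewrite !inE /=.
  by rewrite andbA.
apply: (@leq_trans (\sum_(B in F) 2 ^ k)%N); last by rewrite sum_nat_const mulnC.
rewrite big_mkcondr /= leq_sum // => B _; case: eqP => // <-.
by rewrite card_powerset.
Qed.

Lemma supp_signed_vector (R : realType) (p k : nat) (B C : {set 'I_p}) :
  (0 < k)%N -> supp (signed_vector R k (B, C)) = B.
Proof.
move=> k0; apply/setP => i; rewrite inE tnth_mktuple /=.
have /lt0r_neq0 e0 := entry_size_gt0 R k0.
by case: ifP => _; rewrite ?eqxx//; case: ifP; rewrite ?oppr_eq0 e0.
Qed.

Lemma signed_vector_prior (R : realType) (kind : prior_kind) (p k : nat)
    (B : {set 'I_p}) : (0 < k)%N -> #|B| = k ->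
  prior_vectors R kind p k (signed_vector R k (B, B)).
Proof.
move=> k0 Bk; split.
  by move=> i; rewrite tnth_mktuple /= -/(entry_size R k); case: kind;
    case: (i \in B) => /=; tauto.
rewrite -[in RHS]Bk -[in RHS](supp_signed_vector R B B k0).
by apply: eq_card => i; rewrite !inE.
Qed.

(** Nonnegative vectors are available in both priors, one for each support. *)
Lemma card_prior_ge (R : realType) (kind : prior_kind) (p k : nat) : (0 < k)%N ->
  ('C(p, k) <= #|` fset_set (prior_vectors R kind p k)|)%N.
Proof.
move=> k0; rewrite -[X in 'C(X, _)]card_ord -card_draws.
set D := [set _ | _]%SET; pose h (B : {set 'I_p}) := signed_vector R k (B, B).
have h_inj : {in D &, injective h}.
  by move=> B B' _ _ /(congr1 supp); rewrite !supp_signed_vector.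
apply: (@leq_trans #|` [fset h B | B in D]%fset|).
  by rewrite card_in_imfset //= -cardE.
apply: fsubset_leq_card; apply/fsubsetP => _ /imfsetP[B /= /[!inE] /eqP Bk ->].
rewrite in_fset_set ?inE; last exact: finite_prior_vectors.
exact: signed_vector_prior.
Qed.

(** Expanding the d-th power of the sum over i of x_i y_i gives one term for each
multi-index. *)
Lemma inner_tensor_power (R : realType) (d p : nat) (x y : Rvec R p) :
  inner (tensor_power d x) (tensor_power d y) = inner x y ^+ d.
Proof.
rewrite /inner -[in RHS](card_ord d) -prodr_const bigA_distr_bigA /=.
pose h (j : 'I_(p ^ d)) : {ffun 'I_d -> 'I_p} :=
  [ffun a => tnth (multi_index j) a].
rewrite (reindex h) /=; last first.
  pose g (f : {ffun 'I_d -> 'I_p}) : 'I_(p ^ d) :=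
    cast_ord (card_multi_index d p) (enum_rank [tuple f a | a < d]).
  exists g => [j _|f _].
    rewrite /g (_ : [tuple _ | _ < d] = multi_index j).
      by rewrite /multi_index enum_valK cast_ordKV.
    by apply: eq_from_tnth => a; rewrite tnth_mktuple ffunE.
  apply/ffunP => a; rewrite ffunE /multi_index /g cast_ordK enum_rankK.
  by rewrite tnth_mktuple.
apply: eq_bigr => j _.
rewrite !tnth_mktuple -big_split /=; apply: eq_bigr => a _.
by rewrite ffunE.
Qed.

(** Only the common support contributes, and every product of two entries there
has absolute value 1/k. *)
Lemma normr_inner_le_overlap (R : realType) (kind : prior_kind) (p k : nat)
    (x y : Rvec R p) : (0 < k)%N ->
  prior_vectors R kind p k x -> prior_vectors R kind p k y ->
  `|inner x y| <= #|supp x :&: supp y|%:R / k%:R.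
Proof.
move=> k0 Sx Sy.
rewrite (_ : inner x y =
  \sum_(i in supp x :&: supp y) (tnth x i : R) * tnth y i); last first.
  rewrite [RHS]big_mkcond /=; apply: eq_bigr => i _; rewrite !inE.
  case: eqP => [->|_] /=; first by rewrite mul0r.
  by case: eqP => [->|_] //=; rewrite mulr0.
apply: le_trans (ler_norm_sum _ _ _) _.
rewrite mulr_natl -sumr_const; apply: ler_sum => i _.
have e0 := ltW (entry_size_gt0 R k0).
have le_e (z : Rvec R p) : prior_vectors R kind p k z ->
    `|tnth z i : R| <= entry_size R k.
  move=> Sz; case: (prior_entryP i Sz) => ->;
    by rewrite ?normr0 ?normrN ?ger0_norm.
by rewrite normrM -entry_size_sqr expr2 ler_pM// le_e.
Qed.

(** * The support of the induced prior *)

Lemma induced_priorE (R : realType) (kind : prior_kind) (d p k : nat)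
    (A : set (Rvec R (p ^ d))) : (0 < k <= p)%N ->
  induced_prior R kind d p k A =
    (#|` fset_set (prior_vectors R kind p k `&` @tensor_power R d p @^-1` A)|%:R /
     #|` fset_set (prior_vectors R kind p k)|%:R)%:E.
Proof.
move=> kp; rewrite /= /pushforward /uniform_on asboolT //; split.
  exact: finite_prior_vectors.
exact: prior_vectors_neq0.
Qed.

Lemma support_induced_prior (R : realType) (kind : prior_kind) (d p k : nat) :
  (0 < k <= p)%N ->
  [set X : Rvec R (p ^ d) | induced_prior R kind d p k [set X] != 0%E] =
  @tensor_power R d p @` prior_vectors R kind p k.
Proof.
move=> kp; have [k0 _] := andP kp.
have fS := finite_prior_vectors R kind p k.
have S0 : #|` fset_set (prior_vectors R kind p k)|%:R != 0 :> R.
  have [x Sx] := prior_vectors_neq0 R kind kp.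
  rewrite pnatr_eq0 cardfs_eq0; apply/negP => /eqP E.
  have : x \in fset_set (prior_vectors R kind p k) by rewrite in_fset_set // inE.
  by rewrite E inE.
apply/seteqP; split => [X|_ [x Sx <-]].
  rewrite /mkset induced_priorE // eqe mulf_eq0 negb_or => /andP[+ _].
  rewrite pnatr_eq0 cardfs_eq0 => /fset0Pn[x].
  rewrite in_fset_set; last exact: finite_setIl.
  by rewrite inE => -[Sx /= xX]; exists x.
rewrite /mkset induced_priorE // eqe mulf_neq0 ?invr_eq0 //.
rewrite pnatr_eq0 cardfs_eq0; apply/fset0Pn; exists x.
by rewrite in_fset_set ?inE//; exact: finite_setIl.
Qed.

Lemma support_card_le (R : realType) (kind : prior_kind) (d p k : nat) :
  (0 < k <= p)%N ->
  (support_card (induced_prior R kind d p k) <= 2 ^ k * 'C(p, k))%N.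
Proof.
move=> kp; have fS := finite_prior_vectors R kind p k.
rewrite /support_card support_induced_prior // fset_set_image //.
apply: (leq_trans (leq_imfset_card _ _ _)) => /=.
have := card_prior_supp_le R kind k [set B : {set 'I_p} | #|B| == k]%SET.
rewrite card_draws card_ord (_ : _ `&` _ = prior_vectors R kind p k) //.
apply/seteqP; split=> [x []//|x Sx]; split=> //=.
by rewrite inE (card_supp_prior Sx).
Qed.

(** The diagonal coordinate (i, ..., i) of the tensor power is the d-th power of
the i-th entry, so that it detects the support even when d is even and the sign
of the vector is lost. *)
Lemma supp_tensor_power_inj (R : realType) (d p : nat) (x y : Rvec R p) :
  (0 < d)%N -> tensor_power d x = tensor_power d y -> supp x = supp y.
Proof.
move=> d0 E; apply/setP => i; rewrite !inE.
pose j : 'I_(p ^ d) :=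
  cast_ord (card_multi_index d p) (enum_rank [tuple i | a < d]).
have coord (z : Rvec R p) : tnth (tensor_power d z) j = tnth z i ^+ d.
  rewrite tnth_mktuple -[in RHS](card_ord d) -prodr_const.
  apply: eq_bigr => a _.
  by rewrite /multi_index /j cast_ordK enum_rankK tnth_mktuple.
have := coord x; rewrite E coord => /(congr1 (fun r : R => r != 0)).
by rewrite !expf_eq0 d0.
Qed.

(** For 0 < k < p there are at least two sets of size k, and the tensor powers of
their normalized indicators differ.  If the induced prior had a single atom, the
logarithm of its cardinality would vanish, and the quotient by it would carry no
information. *)
Lemma support_card_gt1 (R : realType) (kind : prior_kind) (d p k : nat) :
  (0 < d)%N -> (0 < k < p)%N ->
  (1 < support_card (induced_prior R kind d p k))%N.
Proof.
move=> d0 /andP[k0 kp]; have kp' : (0 < k <= p)%N by rewrite k0 ltnW.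
rewrite /support_card support_induced_prior // fset_set_image; last first.
  exact: finite_prior_vectors.
pose h (B : {set 'I_p}) := tensor_power d (signed_vector R k (B, B)).
set D := [set B : {set 'I_p} | #|B| == k]%SET.
have h_inj : {in D &, injective h}.
  by move=> B B' _ _ /(supp_tensor_power_inj d0); rewrite !supp_signed_vector.
apply: (@leq_trans #|` [fset h B | B in D]%fset|).
  rewrite card_in_imfset //= -cardE card_draws card_ord.
  rewrite -(prednK (leq_ltn_trans (leq0n k) kp)) -(prednK k0) binS.
  by rewrite -addn1 leq_add // bin_gt0; lia.
apply: fsubset_leq_card; apply/fsubsetP => _ /imfsetP[B /= /[!inE] /eqP Bk ->].
apply/imfsetP; exists (signed_vector R k (B, B)) => //=.
rewrite in_fset_set ?inE; last exact: finite_prior_vectors.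
exact: signed_vector_prior.
Qed.

(** * The pair probability *)

(** The uniform measure is a finite average of Dirac masses at points of S, so
only the values of f on S contribute. *)
Lemma le_integral_uniform_on (R : realType) (dT : measure_display)
    (T : measurableType dT) (S : set T) (f : T -> \bar R) (c : R) :
  finite_set S -> S !=set0 -> measurable_fun setT f ->
  (forall x, (0 <= f x)%E) -> 0 <= c -> (forall x, S x -> (f x <= c%:E)%E) ->
  (\int[uniform_on R S]_x f x <= c%:E)%E.
Proof.
move=> fS S0 mf f0 c0 fc.
rewrite (uniform_onE R fS S0) ge0_integral_mscale //= ge0_integral_measure_sum //.
set N := #|` fset_set S|.
apply: (@le_trans _ _ ((N%:R^-1)%:E * \sum_(i < N) c%:E)%E).
  rewrite lee_wpmul2l ?lee_fin ?invr_ge0 //; apply: lee_sum => i _.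
  rewrite integral_dirac // diracT mul1e; apply: fc.
  by have := mem_nth point (ltn_ord i); rewrite in_fset_set // inE.
rewrite sumEFin -EFinM lee_fin sumr_const card_ord -[c *+ _]mulr_natl mulrA.
have [->|N0] := eqVneq (N%:R : R) 0; first by rewrite invr0 !mul0r.
by rewrite mulVf// mul1r.
Qed.

Lemma measurable_inner_ge (R : realType) (n : nat) (t : R) :
  measurable [set XX : Rvec R n * Rvec R n | t <= inner XX.1 XX.2].
Proof.
rewrite (_ : [set _ | _] = [set: Rvec R n * Rvec R n] `&`
    (fun XX : Rvec R n * Rvec R n => inner XX.1 XX.2) @^-1` `[t, +oo[); last first.
  by rewrite setTI; apply/seteqP; split=> XX /=; rewrite in_itv /= andbT.
suff mf : measurable_fun setT (fun XX : Rvec R n * Rvec R n => inner XX.1 XX.2).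
  by apply: mf.
apply: measurable_sum => j; apply: measurable_funM.
  by apply: measurableT_comp (measurable_tnth j) _.
by apply: measurableT_comp (measurable_tnth j) _.
Qed.

(** By Fubini it is enough to bound the sections at the atoms of the prior. *)
Lemma pair_prob_le_section (R : realType) (kind : prior_kind) (d p k : nat)
    (t c : R) :
  (0 < k <= p)%N -> 0 <= c ->
  let A := [set XX : Rvec R (p ^ d) * Rvec R (p ^ d) | t <= inner XX.1 XX.2] in
  (forall x, prior_vectors R kind p k x ->
     (induced_prior R kind d p k (xsection A (tensor_power d x)) <= c%:E)%E) ->
  ((induced_prior R kind d p k \x induced_prior R kind d p k) A <= c%:E)%E.
Proof.
move=> kp c0 A section_le.
have mA : measurable A by exact: measurable_inner_ge.
rewrite /product_measure1 ge0_integral_pushforward //; last first.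
  exact: measurable_fun_xsection.
rewrite preimage_setT; apply: le_integral_uniform_on => //.
- exact: finite_prior_vectors.
- exact: prior_vectors_neq0.
- apply: measurableT_comp; last exact: measurable_tensor_power.
  exact: measurable_fun_xsection.
Qed.

(** Of the factor 4^k, one 2^k counts the signs and the other one bounds
'C(k, m). *)
Lemma pair_prob_le (R : realType) (kind : prior_kind) (d p k m : nat) (t : R) :
  (0 < k <= p)%N -> (m <= k)%N ->
  (forall x y, prior_vectors R kind p k x -> prior_vectors R kind p k y ->
     t <= inner x y ^+ d -> (m <= #|supp x :&: supp y|)%N) ->
  ((induced_prior R kind d p k \x induced_prior R kind d p k)
    [set XX | (t <= inner XX.1 XX.2)%R] <=
    (4 ^+ k * (k%:R / p%:R) ^+ m)%:E)%E.
Proof.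
move=> kp mk overlap; have [k0 kp'] := andP kp.
set P := induced_prior R kind d p k.
have p0 : 0 < p%:R :> R by rewrite ltr0n (leq_trans k0).
have fS := finite_prior_vectors R kind p k.
apply: pair_prob_le_section => //.
move=> x Sx; set A := [set _ | _].
rewrite induced_priorE // lee_fin.
set N := #|` fset_set (prior_vectors R kind p k)|.
have N_ge : 'C(p, k)%:R <= N%:R :> R by rewrite ler_nat card_prior_ge.
have C0 : 0 < 'C(p, k)%:R :> R by rewrite ltr0n bin_gt0.
have N0 : 0 < N%:R :> R by apply: lt_le_trans N_ge.
rewrite ler_pdivrMr //.
have -> : 4 ^+ k * (k%:R / p%:R) ^+ m * N%:R =
   (2 ^ k * (2 ^ k))%:R * ((k ^ m)%:R * N%:R) / (p ^ m)%:R :> R.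
  rewrite expr_div_n !natrM !natrX -exprMn -natrM; ring.
rewrite ler_pdivlMr ?ltr0n ?expn_gt0 ?(leq_trans k0)// -!natrM ler_nat.
set F := [set B : {set 'I_p} | (#|B| == k) && (m <= #|supp x :&: B|)%N]%SET.
apply: (@leq_trans (2 ^ k * (2 ^ k * 'C(p - m, k - m)) * p ^ m)%N); last first.
  rewrite -!mulnA !leq_mul2l; do 2!(apply/orP; right).
  apply: leq_trans (bin_ratio _) _; first by rewrite mk.
  by rewrite leq_mul2l; apply/orP; right; rewrite -(ler_nat R).
rewrite leq_mul2r; apply/orP; right.
have FE : (#|F| <= 2 ^ k * 'C(p - m, k - m))%N.
  apply: (leq_trans (card_big_overlap _ _ _)); rewrite card_ord leq_mul2r.
  apply/orP; right; rewrite (card_supp_prior Sx).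
  rewrite -[X in 'C(X, _)]card_ord -[X in (2 ^ X)%N]card_ord -cardsT.
  rewrite -cards_draws -card_powerset; apply/subset_leq_card/fintype.subsetP.
  by move=> B; rewrite !inE => /andP[].
apply: leq_trans (leq_mul (leqnn (2 ^ k)) FE).
apply: leq_trans (card_prior_supp_le R kind k F).
apply: fsubset_leq_card; rewrite -fset_set_sub; [|exact: finite_setIl..].
move=> y [Sy]; rewrite /= /xsection /= inE /A /= => ty; split => //=.
rewrite inE (card_supp_prior Sy) eqxx /=; apply: overlap => //.
by rewrite -inner_tensor_power.
Qed.

(** * Asymptotics *)

Lemma limn_esup_le_near (R : realType) (u : (\bar R)^nat) (c : \bar R) :
  (\forall n \near \oo, (u n <= c)%E) -> (limn_esup u <= c)%E.
Proof.
move=> uc; rewrite /limn_esup limf_esupE.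
apply: ge_ereal_inf => /=.
exists (ereal_sup [set u n | n in [set n | (u n <= c)%E]]).
  by exists [set n | (u n <= c)%E].
by apply: ge_ereal_sup => _ [n /= un <-].
Qed.

(** Eventually k <= c p with c the minimum of exp(-K) and 1/2: the first bound on
c gives K <= ln (p/k), the second one k < p. *)
Lemma near_ln_ratio_ge (R : realType) (k : nat -> nat) (K : R) :
  (forall p, (0 < p)%N -> (1 <= k p <= p)%N) ->
  (fun p => (k p)%:R : R^o) =o_\oo (fun p => p%:R : R^o) ->
  \forall p \near \oo, (0 < k p < p)%N /\ K <= ln (p%:R / (k p)%:R : R).
Proof.
move=> k_range /eqoP k_small.
pose c : R := Num.min (expR (- K)) 2^-1.
have c0 : 0 < c by rewrite lt_min expR_gt0 invr_gt0 ltr0n.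
near=> p.
have p0 : (0 < p)%N by near: p; exact: nbhs_infty_gt.
have /andP[k0 _] := k_range p p0.
have : `|(k p)%:R : R^o| <= c * `|p%:R : R^o| by near: p; exact: k_small.
rewrite !ger0_norm // => kc.
have p0' : 0 < p%:R :> R by rewrite ltr0n.
have k0' : 0 < (k p)%:R :> R by rewrite ltr0n.
split.
  rewrite k0 /= -(ltr_nat R); apply: le_lt_trans kc _.
  have : c <= 2^-1 by rewrite ge_min lexx orbT.
  nra.
rewrite -(@ler_expR R) lnK ?posrE ?divr_gt0// ler_pdivlMr //.
have cK : c <= expR (- K) by rewrite ge_min lexx.
rewrite -ler_pdivlMl ?expR_gt0 // -expRN; apply: le_trans kc _.
by rewrite ler_wpM2r // ltW.
Unshelve. all: by end_near. Qed.

Section fixed_dimension.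
Context (R : realType) (kind : prior_kind) (d p k : nat).
Context (d_ge2 : (2 <= d)%N) (kp : (0 < k < p)%N).
Local Notation P := (induced_prior R kind d p k).
Local Notation L := (ln (p%:R / k%:R : R)).

Let k0 : 0 < k%:R :> R. Proof. by rewrite ltr0n; case/andP: kp. Qed.
Let p0 : 0 < p%:R :> R.
Proof. by rewrite ltr0n; case/andP: kp => _; exact: leq_ltn_trans. Qed.
Let kp' : (0 < k <= p)%N. Proof. by case/andP: kp => -> /ltnW ->. Qed.

Lemma ln_support_card_le :
  ln (support_card P)%:R <= k%:R * (1 + ln 2 + L) :> R.
Proof.
have r0 : 0 < p%:R / k%:R :> R by rewrite divr_gt0.
apply: (@le_trans _ _ (ln ((expR 1 * 2 * (p%:R / k%:R)) ^+ k))).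
  rewrite ler_ln ?posrE ?exprn_gt0 ?mulr_gt0 ?expR_gt0 ?invr_gt0 //; last first.
    by rewrite ltr0n (ltn_trans _ (support_card_gt1 _ _ (ltnW d_ge2) kp)).
  apply: (@le_trans _ _ (2 ^ k * 'C(p, k))%:R).
    by rewrite ler_nat; exact: support_card_le.
  rewrite natrM natrX (mulrC (expR 1)) -mulrA exprMn.
  apply: ler_wpM2l; first exact: exprn_ge0.
  by apply: bin_le_expR; case/andP: kp.
rewrite lnXn ?mulr_gt0 ?expR_gt0 ?invr_gt0 // -[leLHS]mulr_natl ler_wpM2l //.
by rewrite !lnM ?posrE ?mulr_gt0 ?expR_gt0 ?invr_gt0 // expRK.
Qed.

(** With o the overlap divided by k, the event gives s^2 <= t <= o^d <= o^2, so
that the overlap is at least the ceiling m of s k.  As L >= 0, replacing m by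
s k only increases k ln 4 - m L. *)
Lemma lne_pair_prob_le (s t : R) : 0 <= s <= 1 -> s ^+ 2 <= t ->
  (lne ((P \x P) [set XX | (t <= inner XX.1 XX.2)%R])
    <= (k%:R * (ln 4 - s * L))%:E)%E.
Proof.
case/andP=> s0 s1 st.
have r0 : 0 < p%:R / k%:R :> R by rewrite divr_gt0.
have L0 : 0 <= L.
  by rewrite ln_ge0 // ler_pdivlMr // mul1r ler_nat; case/andP: kp'.
(* The least natural number m with s * k <= m. *)
pose m := `|Num.ceil (s * k%:R)|%N.
have mE : m%:R = (Num.ceil (s * k%:R))%:~R :> R.
  by rewrite natr_absz ger0_norm // -(ceil0 R) le_ceil // mulr_ge0.
have m_le n : s * k%:R <= n%:R -> (m <= n)%N.
  by rewrite -(ler_nat R) mE -[n%:R]/(n%:~R) ler_int ceil_le_int.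
have m_ge : s * k%:R <= m%:R by rewrite mE ceil_ge.
have mk : (m <= k)%N by apply: m_le; rewrite ler_piMl.
apply: (@le_trans _ _ (lne (4 ^+ k * (k%:R / p%:R) ^+ m)%:E)).
  rewrite lee_lne ?in_itv /= ?leey ?measure_ge0 ?lee_fin ?andbT.
  - apply: pair_prob_le => // x y Sx Sy t_le.
    set o := #|_ :&: _|; apply: m_le; rewrite -ler_pdivlMr //.
    have xy : `|inner x y| <= o%:R / k%:R.
      by apply: normr_inner_le_overlap Sx Sy; case/andP: kp.
    have o0 : 0 <= o%:R / k%:R :> R by rewrite divr_ge0.
    have o1 : o%:R / k%:R <= 1 :> R.
      rewrite ler_pdivrMr // mul1r ler_nat -(card_supp_prior Sx).
      by apply: subset_leq_card; exact: finset.subsetIl.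
    rewrite -(@ler_sqr R) ?nnegrE //.
    apply: le_trans st _; apply: le_trans t_le _; apply: le_trans (ler_norm _) _.
    rewrite normrX; apply: le_trans (lerXn2r _ _ _ xy) _; rewrite ?nnegrE //.
    by rewrite ler_wiXn2l.
  - by [].
  by rewrite mulr_ge0 // exprn_ge0 // divr_ge0 // ltW.
have q0 : 0 < k%:R / p%:R :> R by rewrite divr_gt0.
rewrite lne_EFin ?mulr_gt0 ?exprn_gt0 // lee_fin.
rewrite lnM ?posrE ?exprn_gt0 // !lnXn //.
have -> : ln (k%:R / p%:R) = - L by rewrite -lnV ?posrE// invf_div.
rewrite -[ln 4 *+ k]mulr_natl -[_ *+ m]mulr_natl; nra.
Qed.

(** The hypothesis on L makes the O(k) corrections at most e k L.  The logarithm
of the cardinality is only bounded above, which suffices when the claimed bound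
is negative; otherwise the claim holds because a log-probability is
nonpositive. *)
Lemma log_prob_ratio_le (t e : R) : 0 <= t <= 1 -> 0 < e ->
  (ln 4 + (1 + ln 2)) / e <= L ->
  ((ln (support_card P)%:R)^-1%:E *
     lne ((P \x P) [set XX | t <= inner XX.1 XX.2]%R)
   <= (- (2 * t / (1 + t)) + e)%:E)%E.
Proof.
move=> /andP[t0 t1] e0; rewrite ler_pdivrMr // => L_ge.
set s := 2 * t / (1 + t).
have t1' : 0 < 1 + t by rewrite ltr_wpDr.
have s0 : 0 <= s by rewrite divr_ge0 ?mulr_ge0 // ltW.
have s1 : s <= 1 by rewrite ler_pdivrMr // mul1r; lra.
have st : s ^+ 2 <= t.
  rewrite expr_div_n ler_pdivrMr ?exprn_gt0 //.
  rewrite -subr_ge0 (_ : _ - _ = t * (1 - t) ^+ 2); last by ring.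
  by rewrite mulr_ge0 // sqr_ge0.
have lnP := @lne_pair_prob_le s t (introT andP (conj s0 s1)) st.
set q := (P \x P)%E _ in lnP *.
have lnM := ln_support_card_le.
have M0 : 0 < ln (support_card P)%:R :> R.
  by rewrite ln_gt0 // ltr1n support_card_gt1 // ltnW.
set M : R := ln _ in lnM M0 *.
have ln2 : 0 <= ln 2 :> R by rewrite ln_ge0 // ler1n.
have q1 : (lne q <= 0)%E.
  rewrite lne_le0.
  apply: pair_prob_le_section => // x _; apply: probability_le1.
  by apply: measurable_xsection; exact (@measurable_inner_ge R (p ^ d) t).
rewrite muleC lee_pdivrMr //.
have [es|es] := leP 0 (- s + e).
  by apply: le_trans q1 _; rewrite lee_fin mulr_ge0 // ltW.
apply: le_trans lnP _; rewrite lee_fin.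
apply: (@le_trans _ _ ((- s + e) * (k%:R * (1 + ln 2 + L)))); last first.
  by rewrite ler_wnM2l // ltW.
(* What remains is ln 4 + s * (1 + ln 2) <= e * (1 + ln 2 + L). *)
rewrite mulrCA ler_wpM2l //.
nra.
Qed.
End fixed_dimension.

Unset Implicit Arguments.

Theorem proposition2 (R : realType) (d : nat) (k : nat -> nat)
    (kind : prior_kind) (t : R)
    (d_ge2 : (2 <= d)%N)
    (k_range : forall p, (0 < p)%N -> (1 <= k p <= p)%N)
    (k_small : (fun p => (k p)%:R : R^o) =o_\oo (fun p => p%:R : R^o))
    (t_range : 0 <= t <= 1) :
  (limn_esup (fun p =>
     let P := induced_prior R kind d p (k p) in
     (ln (support_card P)%:R)^-1%:E *
     lne ((P \x P) [set XX | t <= inner XX.1 XX.2]%R))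
   <= (- (2 * t / (1 + t)))%:E)%E.
Proof.
apply/lee_addgt0Pr => e e0; rewrite -EFinD.
apply: limn_esup_le_near; near=> p.
have [kp L_ge] : (0 < k p < p)%N /\
    (ln 4 + (1 + ln 2)) / e <= ln (p%:R / (k p)%:R : R).
  near: p; exact: near_ln_ratio_ge.
exact: log_prob_ratio_le.
Unshelve. all: by end_near. Qed.
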